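(* Let $n,m,p\ge1$ be integers, let $A$ be a symmetric positive-definite real $n\times n$ matrix, $B\in\mathbf{R}^{n\times m}$ and $C\in\mathbf{R}^{p\times n}$, and assume that $$\dim\bigl(\mathrm{Ker}(\lambda I_n-A)\cap\mathrm{Ker}\,B^\top\cap\mathrm{Ker}\,C\bigr)\le 1\quad\text{for any }\lambda\in\mathbf{R}.$$ Define linear maps $\mathcal{L}_0,\mathcal{L}_1:\mathbf{R}^{n\times n}\to\mathbf{R}^{n\times n}$ by $$\mathcal{L}_0(X)=AXA^{-1}+A^{-1}XA-2X,\qquad \mathcal{L}_1(X)=(BB^\top+C^\top C)X+X(BB^\top+C^\top C),$$ and let $\mathcal{L}:=\mathcal{L}_1+2\mathcal{L}_0$. Then $$\mathrm{Ker}\,\mathcal{L}=\mathrm{Ker}\,\mathcal{L}_1\cap\mathrm{Ker}\,\mathcal{L}_0\subset\mathrm{Ker}\,\mathcal{L}_0\subset\mathrm{Sym}(n).$$ In particular, $\mathcal{L}:\mathrm{Skew}(n)\to\mathrm{Skew}(n)$ is an automorphism. That is, for any $Y\in\mathrm{Skew}(n)$, there exists a unique $X\in\mathrm{Skew}(n)$ with $\mathcal{L}(X)=Y$.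
   Context: $\mathrm{Sym}(n)$ and $\mathrm{Skew}(n)$ denote the vector spaces of symmetric and of skew-symmetric matrices in $\mathbf{R}^{n\times n}$, respectively; $I_n$ is the identity matrix of size $n$; $\mathrm{Ker}$ denotes the kernel of a matrix or of a linear map; the superscript $\top$ denotes the transpose.
   Formalization: The inclusion Ker L_0 ⊂ Sym(n) is false as stated (A = B = I_2, C = 0 gives L_0 = 0); the formal theorem instead proves Ker L_1 ∩ Ker L_0 ⊂ Sym(n), which equals Ker L, and keeps all the other claims. *)

(* Defs.v *)
From HB Require Import structures.
From mathcomp Require Import all_boot all_order all_algebra.
From mathcomp Require Import sesquilinear reals.

Set Implicit Arguments.
Unset Strict Implicit.
Unset Printing Implicit Defensive.

Import Order.TTheory GRing.Theory Num.Theory.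

Local Open Scope ring_scope.

Definition posdefmx (R : realType) (n : nat) (A : 'M[R]_n) : Prop :=
  forall x : 'cV[R]_n, x != 0 -> 0 < (x^T *m A *m x) 0 0.

(* Matrices act on column vectors here, so this is not the row kernel kermx. *)
Definition Ker (R : realType) (m n : nat) (M : 'M[R]_(m, n)) :
  {vspace 'cV[R]_n} :=
  lker (linfun (mulmx M : 'cV[R]_n -> 'cV[R]_m)).

Section Operators.
Variables (R : realType) (n m p : nat).
Variables (A : 'M[R]_n) (B : 'M[R]_(n, m)) (C : 'M[R]_(p, n)).

Definition calL0_fun (X : 'M[R]_n) : 'M[R]_n :=
  A *m X *m invmx A + invmx A *m X *m A - 2%:R *: X.

Definition calL1_fun (X : 'M[R]_n) : 'M[R]_n :=
  (B *m B^T + C^T *m C) *m X + X *m (B *m B^T + C^T *m C).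

Fact calL0_fun_is_linear : linear calL0_fun.
Proof.
move=> a X Y; rewrite /calL0_fun !mulmxDr !mulmxDl -!scalemxAr -!scalemxAl.
rewrite !scalerDr scalerN opprD !scalerA [_ * a]mulrC.
by rewrite [LHS](AC ((2*2)*2) ((1*3*5)*(2*4*6)))/=.
Qed.

HB.instance Definition _ :=
  GRing.isLinear.Build R 'M[R]_n 'M[R]_n _ calL0_fun calL0_fun_is_linear.

Fact calL1_fun_is_linear : linear calL1_fun.
Proof.
move=> a X Y; rewrite /calL1_fun; move: (B *m _ + _) => P.
rewrite mulmxDr mulmxDl.
by rewrite -scalemxAr -scalemxAl scalerDr addrACA.
Qed.

HB.instance Definition _ :=
  GRing.isLinear.Build R 'M[R]_n 'M[R]_n _ calL1_fun calL1_fun_is_linear.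

Definition calL0 : 'End('M[R]_n) := linfun calL0_fun.

Definition calL1 : 'End('M[R]_n) := linfun calL1_fun.

Definition calL : 'End('M[R]_n) := calL1 + 2%:R *: calL0.

Lemma calL0E X :
  calL0 X = A *m X *m invmx A + invmx A *m X *m A - 2%:R *: X.
Proof. by rewrite lfunE. Qed.

Lemma calL1E X :
  calL1 X = (B *m B^T + C^T *m C) *m X + X *m (B *m B^T + C^T *m C).
Proof. by rewrite lfunE. Qed.

Lemma calLE X : calL X = calL1 X + 2%:R *: calL0 X.
Proof. by rewrite add_lfunE scale_lfunE. Qed.

End Operators.

Lemma memv_Ker (R : realType) (m n : nat) (M : 'M[R]_(m, n)) (x : 'cV[R]_n) :
  (x \in Ker M) = (M *m x == 0).
Proof. by rewrite memv_ker lfunE. Qed.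

(* Main.v *)
Require Import Defs.
From mathcomp Require Import all_boot all_order all_algebra.
From mathcomp Require Import sesquilinear reals.
From mathcomp Require Import spectral complex.

Set Implicit Arguments.
Unset Strict Implicit.
Unset Printing Implicit Defensive.

Import Order.TTheory GRing.Theory Num.Theory.

Local Open Scope ring_scope.

(** Both operators are positive semidefinite for the inner product
    [\tr (X^T *m Y)], which forces the kernel of their sum to be the
    intersection of their kernels. For [calL1] the energy [\tr (X^T *m calL1 X)]
    is a sum of squared norms ([energy_calL1]), so that [X] and [X^T] are killed
    on the left by [B^T] and [C] as soon as the energy vanishes. For [calL0],
    put [N = X A^-1 - A^-1 X]; then [calL0 X = A N - N A] and the energy is
    [\tr (A N^T A N)] ([energy_calL0]), which is positive unless [N = 0]
    ([posdef_sandwich]); and [N = 0] says that [X] commutes with [A].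

    For [X] in both kernels, the skew matrix [K = X - X^T] therefore commutes
    with [A] and satisfies [B^T K = 0] and [C K = 0]. If [K] were nonzero, then,
    since the eigenvectors of [A] span the space, some eigenvector [w] of [A]
    would have [u = K w <> 0]. Both [u] and [K u] are in the same eigenspace of
    [A] and in the kernels of [B^T] and [C], so the dimension hypothesis makes
    [K u] a multiple of [u]. But [K u] is orthogonal to [u], by skewness, hence
    [K u = 0], and then [|u|^2 = - w^T K u = 0], a contradiction
    ([skew_comm_eq0]). So [X] is symmetric. On skew matrices, which [calL]
    preserves, [calL] is thus injective, and bijective for reasons of dimension.

    What is needed of the spectral theorem is a resolution of the identity by
    real eigenvectors ([symmetric_eigenframe]), obtained from the unitary
    diagonalization over the complex numbers. *)

(** * Real eigenvectors of a symmetric matrix *)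

Section EigenvectorFrame.
Variable R : rcfType.
Local Notation toC := (map_mx (real_complex R)).
Local Notation i := (Complex 0 1 : R[i]).

Lemma complex_mx_inj m n (X Y X' Y' : 'M[R]_(m, n)) :
  toC X + i *: toC Y = toC X' + i *: toC Y' -> X = X' /\ Y = Y'.
Proof.
move=> /matrixP eqXY; split; apply/matrixP => j k; have := eqXY j k;
  rewrite !mxE /= => -[]; rewrite !(mul0r, mul1r, mulr0, subr0, addr0, add0r) //.
Qed.

Lemma complex_mx_rect m n (W : 'M[R[i]]_(m, n)) :
  exists X Y : 'M[R]_(m, n), W = toC X + i *: toC Y.
Proof.
exists (map_mx (@complex.Re R) W), (map_mx (@complex.Im R) W); apply/matrixP => j k.
by rewrite !mxE [LHS]complexE.
Qed.

(** A real spectral theorem with [n + n] eigenvectors instead of [n]. The columns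
    of a unitary matrix [X + i Y] that diagonalizes [A] are eigenvectors for real
    eigenvalues, so the columns of [X] and of [Y] are zero or real eigenvectors.
    The real part of [(X + i Y)(X + i Y)^* = 1] is [X X^T + Y Y^T = 1]. This
    Parseval frame serves as well as an orthonormal basis, and spares the
    extraction of one. *)
Lemma symmetric_eigenframe n (A : 'M[R]_n) : A^T = A ->
  exists V : 'M[R]_(n, n + n), exists d : 'rV[R]_(n + n),
    V *m V^T = 1%:M /\ A *m V = V *m diag_mx d.
Proof.
move=> symA; pose s := spectral_diag (toC A); pose P := spectralmx (toC A).
have hermA : toC A \is hermsymmx.
  apply: realsym_hermsym.
    by apply/is_hermitianmxP; rewrite expr0 scale1r map_mx_id // map_trmx symA.
  apply/mxOverP => j k; rewrite mxE; apply/complex_realP; by eexists.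
have Auni : P \is unitarymx by exact: spectral_unitarymx.
have /orthomx_spectralP Aspec := hermitian_normalmx hermA.
have [e se] : exists e : 'rV[R]_n, s = toC e.
  exists (map_mx (@complex.Re R) s); apply/matrixP => j k; rewrite !mxE.
  by rewrite RRe_real // (mxOverP (hermitian_spectral_diag_real hermA)).
have [X [Y WXY]] := complex_mx_rect (invmx P).
exists (row_mx X Y), (row_mx e e).
have Punit : P \in unitmx by exact: unitarymx_unit.
have eqAW : toC A *m invmx P = invmx P *m diag_mx s.
  by rewrite {1}Aspec -/P -!mulmxA mulmxV // mulmx1.
have diagC : toC (diag_mx e) = diag_mx (toC e) by rewrite map_diag_mx.
have [AX AY] : A *m X = X *m diag_mx e /\ A *m Y = Y *m diag_mx e.
  apply: complex_mx_inj; rewrite !map_mxM diagC -se.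
  by rewrite scalemxAr -mulmxDr -WXY eqAW WXY mulmxDl scalemxAl.
split; last first.
  rewrite diag_mx_row mul_mx_row AX AY mul_row_block.
  by rewrite !mulmx0 addr0 add0r.
rewrite tr_row_mx mul_row_col.
have PX : P = toC (X^T) - i *: toC (Y^T).
  have -> : P = map_mx (@Num.conj _) (invmx P)^T.
    by rewrite (invmx_unitary Auni) trmxCK.
  rewrite WXY; apply/matrixP => j k; rewrite !mxE /=.
  apply/eqP; rewrite eq_complex /=.
  by rewrite !(mul0r, mul1r, mulr0, subr0, addr0, add0r, oppr0) !eqxx.
have : invmx P *m P = 1%:M by rewrite mulVmx.
rewrite {2}PX WXY mulmxDl !mulmxBr -!scalemxAl -!scalemxAr -!map_mxM scalerA.
have -> : i * i = -1 by rewrite -expr2 sqr_i.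
rewrite scaleN1r opprK => eq1.
have [] // := @complex_mx_inj _ _ (X *m X^T + Y *m Y^T)
   (Y *m X^T - X *m Y^T) 1%:M 0.
rewrite map_mx1 map_mx0 scaler0 addr0 -eq1 map_mxD map_mxB scalerBr.
by rewrite [LHS](AC (2*2) ((1*4)*(3*2))).
Qed.

End EigenvectorFrame.

(** * Squared norms, symmetric and skew-symmetric matrices *)

Section SquareNorm.
Variable R : realDomainType.

Definition sqnorm m n (M : 'M[R]_(m, n)) := \tr (M^T *m M).

Lemma sqnormE m n (M : 'M[R]_(m, n)) :
  sqnorm M = \sum_j \sum_i M i j ^+ 2.
Proof.
by apply: eq_bigr => j _; rewrite mxE; apply: eq_bigr => i _; rewrite mxE.
Qed.

Lemma sqnorm_ge0 m n (M : 'M[R]_(m, n)) : 0 <= sqnorm M.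
Proof.
by rewrite sqnormE; do 2![apply: sumr_ge0 => ? _]; apply: sqr_ge0.
Qed.

Lemma sqnorm_eq0 m n (M : 'M[R]_(m, n)) : (sqnorm M == 0) = (M == 0).
Proof.
apply/idP/eqP => [|->]; last by rewrite /sqnorm mulmx0 mxtrace0.
rewrite sqnormE => M0; apply/matrixP => i j; rewrite mxE.
have := M0; rewrite psumr_eq0 => [/allP/(_ j (mem_index_enum _))/=|k _]; last first.
  by apply: sumr_ge0 => ? _; apply: sqr_ge0.
rewrite psumr_eq0 => [/allP/(_ i (mem_index_enum _))/=|k _].
  by rewrite sqrf_eq0 => /eqP.
exact: sqr_ge0.
Qed.

End SquareNorm.

Lemma mul_col_diag (R : comNzRingType) m n (A : 'M[R]_m) (V : 'M[R]_(m, n)) d k :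
  A *m V = V *m diag_mx d -> A *m col k V = d 0 k *: col k V.
Proof.
move=> AV; apply/colP => i.
move/matrixP/(_ i k): AV; rewrite mul_mx_diag !mxE [RHS]mulrC => <-.
by apply: eq_bigr => j _; rewrite mxE.
Qed.

Lemma mx_opp_fixed (R : realDomainType) m n (M : 'M[R]_(m, n)) : M = - M -> M = 0.
Proof.
move=> /matrixP MN; apply/matrixP => i j; apply/eqP.
by have := MN i j; rewrite !mxE => /esym/eqP; rewrite eqNr.
Qed.

Section SkewSym.
Variable R : fieldType.

Lemma symmetricmxP n (X : 'M[R]_n) : reflect (X^T = X) (X \is symmetricmx).
Proof.
by apply: (iffP (is_hermitianmxP false idfun X)); rewrite expr0 scale1r map_mx_id.
Qed.

Lemma skewmxP n (X : 'M[R]_n) : reflect (X^T = - X) (X \is skewmx).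
Proof.
apply: (iffP (is_hermitianmxP true idfun X)); rewrite expr1 scaleN1r map_mx_id // => E.
  by rewrite {2}E opprK.
by rewrite E opprK.
Qed.

End SkewSym.

(** * Positive-definite matrices *)

Section PosDef.
Variable R : realType.

Lemma posdefmx_unit n (A : 'M[R]_n) : posdefmx A -> A \in unitmx.
Proof.
move=> posA; rewrite -row_free_unit -kermx_eq0; apply: contraT => kerA.
pose v := nz_row (kermx A).
have vA : v *m A = 0 by apply/sub_kermxP/nz_row_sub.
have := posA v^T; rewrite trmx_eq0 nz_row_eq0 => /(_ kerA).
by rewrite trmxK vA mul0mx mxE ltxx.
Qed.

(** In a frame [V] of eigenvectors of [A], the matrix [Z = V^T N V] has
    [\tr (A N^T A N) = \sum_k \sum_l d_k d_l Z_lk ^ 2], and it determines [N]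
    because [V V^T = 1]. The eigenvalue of a nonzero column of [V] is positive.
    The eigenvalue attached to a zero column is arbitrary, but the row and the column of [Z] at that index vanish. *)
Lemma posdef_sandwich n (A N : 'M[R]_n) : A^T = A -> posdefmx A ->
  0 <= \tr (A *m N^T *m A *m N) ?= iff (N == 0).
Proof.
move=> symA posA; have [V [d [VV AV]]] := symmetric_eigenframe symA.
pose Z := V^T *m N *m V.
have AE : A = V *m diag_mx d *m V^T by rewrite -AV -mulmxA VV mulmx1.
have NE : N = V *m Z *m V^T.
  by rewrite /Z !mulmxA VV mul1mx -mulmxA VV mulmx1.
have trE : \tr (A *m N^T *m A *m N) =
    \sum_k \sum_l (d 0 k * d 0 l) * Z l k ^+ 2.
  rewrite {1 2}AE.
  have -> : V *m diag_mx d *m V^T *m N^T *m (V *m diag_mx d *m V^T) *m N =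
     V *m (diag_mx d *m (Z^T *m (diag_mx d *m (V^T *m N)))).
    by rewrite /Z !trmx_mul trmxK !mulmxA.
  rewrite mxtrace_mulC -!mulmxA -/Z [V^T *m _]mulmxA -/Z; apply: eq_bigr => k _.
  rewrite mul_diag_mx mxE mxE mulr_sumr; apply: eq_bigr => l _.
  by rewrite mul_diag_mx !mxE expr2 [LHS](AC (1*(1*(1*1))) ((1*3)*(2*4))).
have d_gt0 k : col k V != 0 -> 0 < d 0 k.
  move=> vk0; have := posA _ vk0.
  have -> : (col k V)^T *m A *m col k V = d 0 k *: ((col k V)^T *m col k V).
    by rewrite -mulmxA (mul_col_diag k AV) -scalemxAr.
  have := sqnorm_ge0 (col k V); rewrite /sqnorm /mxtrace big_ord1 => v_ge0.
  by rewrite mxE; apply: contraTT; rewrite -!leNgt => d_le0; rewrite mulr_le0_ge0.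
have ZE k l : Z l k = ((col l V)^T *m N *m col k V) 0 0.
  by rewrite tr_col -row_mul !mxE; apply: eq_bigr => j _; rewrite !mxE.
have term k l : 0 <= d 0 k * d 0 l * Z l k ^+ 2 ?= iff (Z l k == 0).
  case: (eqVneq (Z l k) 0) => [->|Zlk].
    by rewrite expr0n mulr0; apply/leif_refl.
  have dk : 0 < d 0 k.
    by apply: d_gt0; apply: contraNneq Zlk => v0; rewrite ZE v0 mulmx0 mxE.
  have dl : 0 < d 0 l.
    by apply: d_gt0; apply: contraNneq Zlk => v0; rewrite ZE v0 trmx0 !mul0mx mxE.
  by apply/leifP; apply: mulr_gt0; [exact: mulr_gt0 | rewrite exprn_even_gt0].
rewrite trE; split; first by do 2![apply: sumr_ge0 => ? _]; rewrite term.
apply/eqP/eqP => [/esym T0|N0]; last first.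
  rewrite big1 // => k _; rewrite big1 // => l _.
  by rewrite ZE N0 mulmx0 mul0mx mxE expr0n mulr0.
rewrite NE; suff -> : Z = 0 by rewrite mulmx0 mul0mx.
apply/matrixP => l k; rewrite [RHS]mxE; apply/eqP; rewrite -[_ == 0](term k l).2 eq_sym.
move/eqP: T0; rewrite psumr_eq0 => [/allP/(_ k (mem_index_enum _))/=|? _]; last first.
  by apply: sumr_ge0 => ? _; rewrite term.
by rewrite psumr_eq0 => [/allP/(_ l (mem_index_enum _))/=|? _]; rewrite ?term.
Qed.

End PosDef.

(** * The kernels of the operators *)

Section Kernel.
Variables (R : realType) (n m p : nat).
Variables (A : 'M[R]_n) (B : 'M[R]_(n, m)) (C : 'M[R]_(p, n)).
Hypotheses (symA : A^T = A) (posA : posdefmx A).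

Lemma energy_calL1 (X : 'M[R]_n) :
  \tr (X^T *m calL1 B C X) =
    sqnorm (B^T *m X) + sqnorm (C *m X)
    + (sqnorm (B^T *m X^T) + sqnorm (C *m X^T)).
Proof.
rewrite calL1E !mulmxDl !mulmxDr !mxtraceD; congr (_ + _ + (_ + _)).
- by rewrite /sqnorm !trmx_mul trmxK !mulmxA.
- by rewrite /sqnorm !trmx_mul !mulmxA.
- by rewrite /sqnorm !trmx_mul !trmxK -!mulmxA mxtrace_mulC !mulmxA.
- by rewrite /sqnorm !trmx_mul !trmxK -!mulmxA mxtrace_mulC !mulmxA.
Qed.

(** Up to multiplication by [A] on both sides this is the commutator of [A]
    and [X]; in this form the energy of [calL0] is visibly positive. *)
Definition twist (X : 'M[R]_n) := X *m invmx A - invmx A *m X.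

Lemma calL0_twist X : calL0 A X = A *m twist X - twist X *m A.
Proof.
have uA := posdefmx_unit posA.
rewrite calL0E /twist mulmxBr mulmxBl !mulmxA mulmxV // mul1mx.
rewrite -[X *m invmx A *m A]mulmxA mulVmx // mulmx1 scaler_nat mulr2n !opprD opprK.
by rewrite [RHS](AC (2*2) ((1*4)*(2*3))).
Qed.

Lemma energy_calL0 X :
  \tr (X^T *m calL0 A X) = \tr (A *m (twist X)^T *m A *m twist X).
Proof.
have uA := posdefmx_unit posA.
have -> : A *m (twist X)^T *m A = X^T *m A - A *m X^T.
  rewrite /twist raddfB /= !trmx_mul trmx_inv symA mulmxBr mulmxBl !mulmxA.
  by rewrite mulmxV // mul1mx -[_ *m invmx A *m A]mulmxA mulVmx // mulmx1.
rewrite calL0_twist; move: (twist X) => N.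
rewrite mulmxBr mulmxBl !raddfB /= !mulmxA; congr (_ - _).
by rewrite mxtrace_mulC !mulmxA.
Qed.

Lemma energy_calL1_ge0 X : 0 <= \tr (X^T *m calL1 B C X).
Proof. by rewrite energy_calL1 !addr_ge0 ?sqnorm_ge0. Qed.

Lemma energy_calL0_ge0 X : 0 <= \tr (X^T *m calL0 A X).
Proof. by rewrite energy_calL0 posdef_sandwich. Qed.

Lemma energy_calL1_eq0 X : \tr (X^T *m calL1 B C X) = 0 ->
  [/\ B^T *m X = 0, C *m X = 0, B^T *m X^T = 0 & C *m X^T = 0].
Proof.
move/eqP; rewrite energy_calL1 !paddr_eq0 ?addr_ge0 ?sqnorm_ge0 // !sqnorm_eq0.
by case/andP => /andP[/eqP-> /eqP->] /andP[/eqP-> /eqP->].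
Qed.

Lemma energy_calL0_eq0 X : \tr (X^T *m calL0 A X) = 0 -> twist X = 0.
Proof.
move=> E0; apply/eqP.
by rewrite -(posdef_sandwich (twist X) symA posA).2 -energy_calL0 E0 eqxx.
Qed.

Lemma twist0_comm X : twist X = 0 -> A *m X = X *m A.
Proof.
have uA := posdefmx_unit posA.
move/eqP; rewrite subr_eq0 => /eqP E.
rewrite -[LHS]mulmx1 -(mulVmx uA) mulmxA -[A *m X *m _]mulmxA E.
by rewrite !mulmxA mulmxV // mul1mx.
Qed.

(** Two nonnegative energies with sum zero vanish. Vanishing of the energy of
    [calL0] already gives [calL0 X = 0], through [twist X = 0], and the equation
    [calL X = 0] then leaves [calL1 X = 0]. *)
Lemma ker_calL X :
  (X \in lker (calL A B C)) = (X \in lker (calL1 B C)) && (X \in lker (calL0 A)).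
Proof.
rewrite !memv_ker calLE; apply/eqP/andP => [LX|[/eqP-> /eqP->]]; last first.
  by rewrite scaler0 addr0.
have : \tr (X^T *m (calL1 B C X + 2%:R *: calL0 A X)) == 0.
  by rewrite LX mulmx0 mxtrace0.
rewrite mulmxDr -scalemxAr mxtraceD mxtraceZ paddr_eq0; first last.
- by rewrite mulr_ge0 ?energy_calL0_ge0.
- exact: energy_calL1_ge0.
rewrite mulf_eq0 pnatr_eq0 /= => /andP[_ /eqP/energy_calL0_eq0 twist0].
have L0X : calL0 A X = 0 by rewrite calL0_twist twist0 mulmx0 mul0mx subr0.
by move: LX; rewrite L0X scaler0 addr0 => ->.
Qed.

Hypothesis hABC : forall lambda : R,
  (\dim (Ker (lambda%:M - A) :&: Ker B^T :&: Ker C)%VS <= 1)%N.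

(** A nonzero skew [K] would give, from an eigenvector [w] of [A] such that
    [K w <> 0], two independent vectors [K w] and [K (K w)] of the space whose
    dimension is at most one. *)
Lemma skew_comm_eq0 (K : 'M[R]_n) : K^T = - K -> A *m K = K *m A ->
  B^T *m K = 0 -> C *m K = 0 -> K = 0.
Proof.
move=> skewK commK BK CK; apply/eqP/negPn/negP => K0.
have skew_form (x : 'cV[R]_n) : x^T *m K *m x = 0.
  have tr_form : (x^T *m K *m x)^T = - (x^T *m K *m x).
    by rewrite !trmx_mul trmxK skewK mulNmx mulmxN mulmxA.
  by apply: mx_opp_fixed; rewrite -tr_form; apply/matrixP => j k; rewrite [RHS]mxE !ord1.
have [V [d [VV AV]]] := symmetric_eigenframe symA.
(* The columns of V span, so K cannot kill all of them. *)
have [k KVk] : exists k, K *m col k V != 0.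
  apply/existsP; apply: contraT; rewrite negb_exists => /forallP KV0.
  case/negP: K0; rewrite -[K]mulmx1 -VV mulmxA.
  suff -> : K *m V = 0 by rewrite mul0mx.
  apply/matrixP => i j; have /negPn/eqP/matrixP/(_ i 0) := KV0 j.
  rewrite !mxE => KVij; rewrite -[RHS]KVij.
  by apply: eq_bigr => l _; rewrite mxE.
pose u := K *m col k V.
have Au : A *m u = d 0 k *: u.
  by rewrite /u mulmxA commK -mulmxA (mul_col_diag k AV) -scalemxAr.
pose lambda := d 0 k; pose W := (Ker (lambda%:M - A) :&: Ker B^T :&: Ker C)%VS.
have uW : u \in W.
  rewrite !memv_cap !memv_Ker mulmxBl Au mul_scalar_mx subrr eqxx.
  by rewrite /u !mulmxA BK CK !mul0mx !eqxx.
have KuW : K *m u \in W.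
  rewrite !memv_cap !memv_Ker mulmxBl [A *m _]mulmxA commK -mulmxA Au.
  by rewrite -scalemxAr mul_scalar_mx subrr !mulmxA BK CK !mul0mx !eqxx.
have /vlineP[c Kuc] : K *m u \in <[u]>%VS.
  suff -> : <[u]>%VS = W by [].
  by apply/eqP; rewrite eqEdim -memvE uW dim_vline KVk hABC.
have uu0 : u^T *m u != 0.
  apply: contraNneq KVk => uu0; rewrite -sqnorm_eq0.
  by rewrite /sqnorm -/u uu0 mxtrace0.
have c0 : c = 0.
  have := skew_form u; rewrite -mulmxA Kuc -scalemxAr => /eqP.
  by rewrite scaler_eq0 (negPf uu0) orbF => /eqP.
(* The transpose of one factor u = K w moves K onto the other. *)
case/negP: uu0; rewrite {1}/u trmx_mul skewK mulmxN mulNmx -mulmxA Kuc.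
by rewrite c0 scale0r mulmx0 oppr0.
Qed.

(** The skew matrix [X - X^T] meets the hypotheses of [skew_comm_eq0]. *)
Lemma ker_calL_sym X : X \in lker (calL1 B C) -> X \in lker (calL0 A) -> X^T = X.
Proof.
rewrite !memv_ker => /eqP L1X /eqP L0X.
have [BX CX BXt CXt] : [/\ B^T *m X = 0, C *m X = 0, B^T *m X^T = 0 & C *m X^T = 0].
  by apply: energy_calL1_eq0; rewrite L1X mulmx0 mxtrace0.
have AX : A *m X = X *m A.
  by apply/twist0_comm/energy_calL0_eq0; rewrite L0X mulmx0 mxtrace0.
have AXt : A *m X^T = X^T *m A by rewrite -{1}symA -trmx_mul -AX trmx_mul symA.
apply/esym/subr0_eq/skew_comm_eq0.
- by rewrite raddfB /= trmxK opprB.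
- by rewrite mulmxBr mulmxBl AX AXt.
- by rewrite mulmxBr BX BXt subrr.
- by rewrite mulmxBr CX CXt subrr.
Qed.

Lemma calL_tr X : calL A B C X^T = (calL A B C X)^T.
Proof.
have symP : (B *m B^T + C^T *m C)^T = B *m B^T + C^T *m C.
  by rewrite linearD /= !trmx_mul !trmxK.
rewrite !calLE !calL1E !calL0E; move: (B *m _ + _) symP => P symP.
rewrite !(linearD, linearN, linearZ) /=.
rewrite !trmx_mul trmx_inv symP symA !mulmxA.
by rewrite -!scalerDr; congr (_ + _ *: (_ + _)); rewrite addrC.
Qed.

Lemma calL_skew X : X^T = - X -> (calL A B C X)^T = - calL A B C X.
Proof. by move=> skewX; rewrite -calL_tr skewX linearN. Qed.

Lemma calL_skew_inj X : X^T = - X -> calL A B C X = 0 -> X = 0.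
Proof.
move=> skewX /eqP; rewrite -memv_ker ker_calL => /andP[X1 X0].
by apply: mx_opp_fixed; rewrite -skewX (ker_calL_sym X1 X0).
Qed.

(** The skew matrices form the subspace [S], the kernel of [X |-> X^T + X];
    [calL] maps [S] into itself injectively, and so onto. *)
Lemma calL_skew_surj Y : Y^T = - Y ->
  exists2 X : 'M[R]_n, X^T = - X & calL A B C X = Y.
Proof.
pose S := lker (linfun (@trmx R n n) + \1)%VF.
have memS X : (X \in S) = (X^T == - X).
  by rewrite memv_ker add_lfunE id_lfunE lfunE /= addr_eq0.
move=> skewY; suff: Y \in (calL A B C @: S)%VS.
  by case/memv_imgP => X; rewrite memS => /eqP; exists X.
suff -> : (calL A B C @: S)%VS = S by rewrite memS skewY.
apply/eqP; rewrite eqEdim limg_dim_eq ?leqnn ?andbT.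
  apply/subvP => _ /memv_imgP[X XS ->]; move: XS.
  by rewrite !memS => /eqP/calL_skew ->.
apply/eqP; rewrite -subv0; apply/subvP => X; rewrite memv_cap memS memv_ker memv0.
by case/andP => /eqP skewX /eqP/(calL_skew_inj skewX) ->.
Qed.

End Kernel.

Theorem theorem3 (R : realType) (n m p : nat)
    (hn : (1 <= n)%N) (hm : (1 <= m)%N) (hp : (1 <= p)%N)
    (A : 'M[R]_n) (B : 'M[R]_(n, m)) (C : 'M[R]_(p, n))
    (symA : A \is symmetricmx) (posA : posdefmx A)
    (hABC : forall lambda : R,
       (\dim (Ker (lambda%:M - A) :&: Ker B^T :&: Ker C)%VS <= 1)%N) :
  [/\ lker (calL A B C) = (lker (calL1 B C) :&: lker (calL0 A))%VS,
      (lker (calL1 B C) :&: lker (calL0 A) <= lker (calL0 A))%VS,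
      {subset (lker (calL1 B C) :&: lker (calL0 A))%VS
         <= (symmetricmx : {pred 'M[R]_n})},
      (forall X : 'M[R]_n, X \is skewmx -> calL A B C X \is skewmx)
    & (forall Y : 'M[R]_n, Y \is skewmx ->
         exists! X : 'M[R]_n, X \is skewmx /\ calL A B C X = Y)].
Proof.
have tA : A^T = A by apply/symmetricmxP.
split.
- by apply/vspaceP => X; rewrite memv_cap ker_calL.
- exact: capvSr.
- move=> X; rewrite memv_cap => /andP[X1 X0].
  by apply/symmetricmxP; apply: ker_calL_sym X1 X0.
- by move=> X /skewmxP skewX; apply/skewmxP; apply: calL_skew.
move=> Y /skewmxP /(calL_skew_surj tA posA hABC)[X skewX LX].
exists X; split=> [|X' [/skewmxP skewX' LX']]; first by split=> //; apply/skewmxP.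
apply: subr0_eq; apply: (calL_skew_inj tA posA hABC).
  by rewrite raddfB /= skewX skewX' opprB opprK addrC.
by rewrite linearB /= LX LX' subrr.
Qed.
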